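(* As $r\to\infty$ (over integers $r\ge2$), $$\sup_{\beta\in[-1,1]}\left|\frac{I_r(\beta)}{\log r}-\min\left(\frac{1+|\beta|}{3},\,1-|\beta|\right)\right|=O\left(\frac1{\log r}\right),$$ and $\beta^{*}_r\to\frac12$, $\bar\beta_r\to\frac12$.
   Context: For an integer $r\ge1$ let $F$ be a finite group with identity $e$ and $|F|=r+1$. Let $L_F=F\wr\mathbb{Z}$ be the group of pairs $x=(\eta,j)$ with $\eta:\mathbb{Z}\to F$ finitely supported and $j\in\mathbb{Z}$, with multiplication $(\eta,j)(\eta',j')=(\eta\cdot\tau_j\eta',\,j+j')$, where $\tau_j\eta'(i)=\eta'(i-j)$ and the product of configurations is pointwise in $F$. The standard generating set is $S=\{t^{\pm1}\}\cup(F\setminus\{e\})$, where $t=(\mathbf{e},1)$ with $\mathbf e$ the trivial configuration, and $c\in F\setminus\{e\}$ is identified with $(\delta^c,0)$, $\delta^c$ being equal to $c$ at $0$ and trivial elsewhere. Let $|x|$ be the word length with respect to $S$ and $\pi(\eta,j)=j$. For $j\in\mathbb{Z}$, $n\ge0$ put $N_j(n)=\#\{x\in L_F:|x|\le n,\ \pi(x)=j\}$. The directional growth spectrum is $I_r(\beta)=\lim_{n\to\infty}\frac1n\log N_{\lfloor\beta n\rfloor}(n)$ for $\beta\in[-1,1]$ (the limit exists for every such $\beta$ and depends on $F$ only through $r$). Let $\rho_r>1$ be the unique real number $>1$ with $\rho_r^3=\rho_r+r$, $\omega_r=\frac{1+\sqrt{1+4r}}2$ (so $\omega_r^2=\omega_r+r$),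 $u_r=r/(r+\rho_r)$, $\beta^{*}_r=\frac1{1+u_r}$, and $\bar\beta_r=\frac{\omega_r^2}{\omega_r^2+r}$. *)

(* Defs.v *)
From HB Require Import structures.
From mathcomp Require Import all_boot all_order all_fingroup all_algebra finmap.
From mathcomp Require Import all_classical all_reals all_analysis.
From mathcomp Require Import ring lra.

Set Implicit Arguments.
Unset Strict Implicit.
Unset Printing Implicit Defensive.

Import Order.TTheory GRing.Theory Num.Theory.
Import numFieldNormedType.Exports.

Local Open Scope classical_set_scope.
Local Open Scope ring_scope.

Definition config (F : finGroupType) := {fsfun int -> F with 1%g}.

Record lamplighter (F : finGroupType) :=
  Lamplighter { lamps : config F; cursor : int }.

Section Lamplighter.
Variable F : finGroupType.
Implicit Types (f g h : config F) (i j k : int) (x y z : lamplighter F).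

Definition lamplighter_pair x := (lamps x, cursor x).
Definition pair_lamplighter (p : config F * int) := Lamplighter p.1 p.2.
Lemma lamplighter_pairK : cancel lamplighter_pair pair_lamplighter.
Proof. by case. Qed.

HB.instance Definition _ :=
  Choice.copy (lamplighter F) (can_type lamplighter_pairK).

Definition conf1 : config F := [fsfun].

(* The pointwise product f * tau_j g; the finite set after 'in' only bounds
   the support, see cmulE. *)
Definition cmul f j g : config F :=
  [fsfun i in (finsupp f `|` [fset (k + j)%R | k : int in finsupp g])%fset =>
     (f i * g (i - j))%g | 1%g].

Lemma conf1E i : conf1 i = 1%g.
Proof. by rewrite fsfunE. Qed.

Lemma cmulE f j g i : cmul f j g i = (f i * g (i - j))%g.
Proof.
rewrite fsfunE; case: ifPn => //; rewrite in_fsetU negb_or => /andP[fi gi].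
rewrite (fsfun_dflt fi) mul1g fsfun_dflt//.
apply: contra gi => gi; apply/imfsetP; exists (i - j) => //=.
by rewrite subrK.
Qed.

Definition cinv f j : config F :=
  [fsfun i in [fset (k - j)%R | k : int in finsupp f]%fset => (f (i + j))^-1%g | 1%g].

Lemma cinvE f j i : cinv f j i = (f (i + j))^-1%g.
Proof.
rewrite fsfunE; case: ifPn => // fi.
rewrite fsfun_dflt ?invg1//; apply: contra fi => fi.
by apply/imfsetP; exists (i + j) => //=; rewrite addrK.
Qed.

Definition lmul x y :=
  Lamplighter (cmul (lamps x) (cursor x) (lamps y)) (cursor x + cursor y).
Definition lone := Lamplighter conf1 0.
Definition linv x := Lamplighter (cinv (lamps x) (cursor x)) (- cursor x).

Lemma lmulA : associative lmul.
Proof.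
move=> x y z; congr Lamplighter; last by rewrite /= addrA.
by apply/fsfunP => i; rewrite !cmulE /= mulgA opprD addrA.
Qed.

Lemma lmul1 : left_id lone lmul.
Proof.
move=> [f j]; congr Lamplighter; last by rewrite /= add0r.
by apply/fsfunP => i; rewrite cmulE conf1E mul1g subr0.
Qed.

Lemma l1mul : right_id lone lmul.
Proof.
move=> [f j]; congr Lamplighter; last by rewrite /= addr0.
by apply/fsfunP => i; rewrite cmulE conf1E mulg1.
Qed.

Lemma lmulV : left_inverse lone linv lmul.
Proof.
move=> [f j]; congr Lamplighter; last by rewrite /= addNr.
by apply/fsfunP => i; rewrite cmulE /= cinvE opprK mulVg conf1E.
Qed.

Lemma lVmul : right_inverse lone linv lmul.
Proof.
move=> [f j]; congr Lamplighter; last by rewrite /= subrr.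
by apply/fsfunP => i; rewrite cmulE /= cinvE subrK mulgV conf1E.
Qed.

HB.instance Definition _ :=
  isGroup.Build (lamplighter F) lmulA lmul1 l1mul lmulV lVmul.

Definition shift : lamplighter F := Lamplighter conf1 1.

Definition delta (c : F) : config F := [fsfun i in [fset 0]%fset => c | 1%g].

Definition lamp (c : F) : lamplighter F := Lamplighter (delta c) 0.

Definition gens : pred (lamplighter F) :=
  [pred x | [|| x == shift, x == shift^-1%g |
             [exists c : F, (c != 1%g) && (x == lamp c)]]].

Definition is_word (x : lamplighter F) : pred nat :=
  fun n => `[< exists w : seq (lamplighter F),
    [/\ all gens w, size w = n & (\prod_(y <- w) y)%g = x] >].

Lemma is_wordM x y m n : is_word x m -> is_word y n -> is_word (x * y)%g (m + n).
Proof.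
move=> /asboolP[v [gv <- <-]] /asboolP[w [gw <- <-]]; apply/asboolP.
by exists (v ++ w); rewrite all_cat gv gw size_cat big_cat.
Qed.

Lemma is_word1 : is_word 1%g 0.
Proof. by apply/asboolP; exists [::]; rewrite big_nil. Qed.

Lemma is_word_gen x : gens x -> is_word x 1.
Proof.
by move=> gx; apply/asboolP; exists [:: x]; rewrite /= gx big_seq1.
Qed.

Lemma lmulE x y : (x * y)%g = lmul x y. Proof. by []. Qed.

Lemma shift_words j : exists n, is_word (Lamplighter conf1 j) n.
Proof.
have nat_case (s : int) : gens (Lamplighter conf1 s) ->
    forall m : nat, exists n, is_word (Lamplighter conf1 (s *+ m)) n.
  move=> gs; elim=> [|m [n IH]]; first by exists 0; exact: is_word1.
  exists (1 + n)%N; have := is_wordM (is_word_gen gs) IH.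
  rewrite lmulE /lmul /= -mulrS; congr (is_word (Lamplighter _ _) _).
  by apply/fsfunP => i; rewrite cmulE !conf1E mulg1.
case: (intP j) => [|m|m]; first by exists 0; exact: is_word1.
- have := nat_case 1 _ m.+1; rewrite -[1 *+ _]/(m.+1%:R) natz; apply.
  by rewrite /gens /= eqxx.
- have := nat_case (-1) _ m.+1; rewrite mulNrn -[1 *+ _]/(m.+1%:R) natz; apply.
  rewrite /gens /=; apply/or3P/Or32/eqP; congr Lamplighter.
  by apply/fsfunP => i; rewrite cinvE !conf1E invg1.
Qed.

Lemma deltaE c i : delta c i = if i == 0 then c else 1%g.
Proof. by rewrite fsfunE in_fset1. Qed.

Lemma gens_generate x : exists n, is_word x n.
Proof.
case: x => f j; move: {2}#|`finsupp f| (leqnn #|`finsupp f|) => m.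
elim: m f => [|m IH] f.
  rewrite leqn0 cardfs_eq0 => /eqP f0.
  suff -> : f = conf1 by exact: shift_words.
  by apply/fsfunP => i; rewrite conf1E fsfun_dflt// f0.
move=> fm; have [f0|[i fi]] := fset_0Vmem (finsupp f).
  by apply: IH; rewrite f0 cardfs0.
have [|n wn] := IH [fsfun f without i].
  by rewrite (finsupp_without _ _ i); move: fm; have := cardfsD1 i (finsupp f); rewrite fi => ->.
have [a wa] := shift_words i; have [b wb] := shift_words (- i).
have gi : gens (lamp (f i)).
  rewrite /gens /=; apply/or3P/Or33/existsP; exists (f i); rewrite eqxx andbT.
  by move: fi; rewrite mem_finsupp.
have := is_wordM (is_wordM (is_wordM wa (is_word_gen gi)) wb) wn.
move=> w; exists (a + 1 + b + n)%N; congr (is_word _ _): w.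
rewrite !lmulE /lmul /= addr0 subrr add0r; congr Lamplighter.
apply/fsfunP => k; rewrite !cmulE !conf1E deltaE fsfun_withE subr0 subr_eq0.
by rewrite mul1g mulg1; case: eqP => [->|_]; rewrite ?mulg1 ?mul1g.
Qed.

Definition wlen x : nat := ex_minn (gens_generate x).

Definition ball_fiber (j : int) (n : nat) : set (lamplighter F) :=
  [set x | (wlen x <= n)%N /\ cursor x = j].

Lemma ball_fiber_finite j n : finite_set (ball_fiber j n).
Proof.
have gfin : finite_set [set x | gens x].
  suff : finite_set ([set shift; shift^-1%g] `|` range lamp).
    apply: sub_finite_set => x /= /or3P[/eqP->|/eqP->|].
    - by left; left.
    - by left; right.
    - by move=> /existsP[c /andP[_ /eqP->]]; right; exists c.
  by rewrite finite_setU; split => //; exact: finite_image.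
have wfin m : finite_set [set x | is_word x m].
  elim: m => [|m IH].
    apply: (@sub_finite_set _ _ [set 1%g]) => // x /= /asboolP[w [_ /size0nil -> <-]].
    by rewrite big_nil.
  have := finite_image2 (fun x y : lamplighter F => (x * y)%g) gfin IH.
  apply: sub_finite_set => x /= /asboolP[[|y w] []] //= /andP[gy gw] [ws] <-.
  rewrite big_cons; exists y => //; exists (\prod_(z <- w) z)%g => //=.
  by apply/asboolP; exists w.
have : finite_set (\bigcup_(m in `I_n.+1) [set x | is_word x m]).
  by apply: bigcup_finite => // m _; exact: wfin.
apply: sub_finite_set => x [xn _]; exists (wlen x) => //=.
by rewrite /wlen; case: ex_minnP.
Qed.

Definition ball_count (j : int) (n : nat) : nat :=
  #|` fset_set (ball_fiber j n)|.

End Lamplighter.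

Section Constants.
Variable R : realType.

(* For |beta| <= 1 the count is at least 1, so ln is applied to a positive
   real, and the limit exists. *)
Definition growth_spectrum (F : finGroupType) (beta : R) : R :=
  limn (fun n : nat =>
    ln (ball_count F (Num.floor (beta * n%:R)) n)%:R / n%:R : R).

Definition spectrum_error (F : finGroupType) (r : nat) (beta : R) : R :=
  `| growth_spectrum F beta / ln r%:R
     - Num.min ((1 + `|beta|) / 3) (1 - `|beta|) |.

(* The default value 0 is irrelevant for r >= 1: see rhoP and rho_unique. *)
Definition rho (r : nat) : R :=
  xget 0 [set x : R | 1 < x /\ x ^+ 3 = x + r%:R].

Lemma rho_unique (r : nat) (x y : R) :
  1 < x -> x ^+ 3 = x + r%:R -> 1 < y -> y ^+ 3 = y + r%:R -> x = y.
Proof.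
move=> x1 ex y1 ey; apply/eqP; rewrite -subr_eq0.
have /eqP : (x - y) * (x ^+ 2 + x * y + y ^+ 2 - 1) = 0.
  by transitivity ((x ^+ 3 - x) - (y ^+ 3 - y)); [ring | rewrite ex ey; ring].
rewrite mulf_eq0 => /orP[//|/eqP e]; exfalso; nra.
Qed.

Lemma rhoP (r : nat) : (1 <= r)%N -> 1 < rho r /\ rho r ^+ 3 = rho r + r%:R.
Proof.
move=> r1; have r1' : 1 <= r%:R :> R by rewrite ler1n.
rewrite /rho; case: xgetP => [x _ //|nex]; exfalso.
pose p : {poly R} := 'X^3 - 'X - r%:R%:P.
have [| |x /andP[x1 _]] := @poly_ivt R p 1 (r%:R + 1); first lra.
  by rewrite !hornerE /=; apply/andP; split; nra.
rewrite /root !hornerE /= => /eqP px.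
have {}px : x ^+ 3 = x + r%:R by lra.
apply: (nex x) => /=; split => //; rewrite lt_neqAle x1 andbT.
by apply/eqP => x1'; move: px; rewrite -x1' expr1n; lra.
Qed.

Definition omega (r : nat) : R := (1 + Num.sqrt (1 + 4 * r%:R)) / 2.
Definition u_ (r : nat) : R := r%:R / (r%:R + rho r).
Definition beta_star (r : nat) : R := 1 / (1 + u_ r).
Definition beta_bar (r : nat) : R := omega r ^+ 2 / (omega r ^+ 2 + r%:R).

End Constants.

(* Main.v *)
(* The length of (eta, j) is |supp eta| plus the length of a shortest walk from
   0 to j through the support, so up to a factor polynomial in n, N_j(n) is the
   maximum over |j| <= L, 2L <= n + |j| of the number W(L, n + |j| - 2L) of words
   of length L over F with at most n + |j| - 2L nontrivial letters.
   Concatenation gives W(L, K) W(L', K') <= W(L + L', K + K'), so this maximum,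
   with |j| rounded suitably, is supermultiplicative in n along |j| = |beta| n
   and Fekete's lemma gives the limit.  Finally
   r^min(L, K) <= W(L, K) <= 2^L r^min(L, K), and min(L, (1 + |beta|) n - 2L) over
   L >= |beta| n is largest at L = max(|beta|, (1 + |beta|) / 3) n, with value
   min((1 + |beta|) / 3, 1 - |beta|) n, so the error in I_r is at most ln 2. *)
Require Import Defs.
From mathcomp Require Import all_boot all_order all_fingroup all_algebra finmap.
From mathcomp Require Import all_classical all_reals all_analysis.
From mathcomp Require Import zify ring lra.
Set Implicit Arguments.
Unset Strict Implicit.
Unset Printing Implicit Defensive.

Import Order.TTheory GRing.Theory Num.Theory.
Import numFieldNormedType.Exports.
Local Open Scope classical_set_scope.
Local Open Scope ring_scope.

(** * Counting words with few nontrivial letters *)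

Section SparseCount.
Local Open Scope nat_scope.
Variable r : nat.

(** This is the truncated binomial sum of C(L, i) r^i over i <= K, the W(L, K) of the overview; the
    recursion splits on the first letter. *)
Fixpoint sparse_count (L K : nat) : nat :=
  if L is L'.+1 then
    sparse_count L' K + (if K is K'.+1 then r * sparse_count L' K' else 0)
  else 1.

Lemma sparse_count0 L : sparse_count L 0 = 1.
Proof. by elim: L => //= L ->. Qed.

Lemma leq_sparse_count L K K' : K <= K' -> sparse_count L K <= sparse_count L K'.
Proof.
elim: L K K' => //= L IH [|K] [|K'] // KK'; first by rewrite leq_add ?IH.
by rewrite leq_add ?leq_mul2l ?IH ?orbT.
Qed.

Lemma sparse_countD L K L' K' :
  sparse_count L K * sparse_count L' K' <= sparse_count (L + L') (K + K').
Proof.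
elim: L K => [|L IH] [|K]; rewrite ?mul1n ?leq_sparse_count ?leq_addl//=.
  by rewrite addn0; apply: leq_trans (IH 0) (leq_addr _ _).
by rewrite addSn mulnDl -mulnA leq_add// ?leq_mul2l ?IH ?orbT// -addSn IH.
Qed.

(** A word with exactly K + 1 nontrivial letters arises from one with K by choosing a position and
    one of r letters. Enlarging the budget by a bounded amount thus costs only a polynomial
    factor. *)
Lemma sparse_countS_le L K :
  sparse_count L K.+1 <= (1 + L * r) * sparse_count L K.
Proof.
elim: L K => [|L IH] [|K] //=.
  have := IH 0; rewrite !sparse_count0; lia.
have := IH K.+1; have := IH K; nia.
Qed.

(** There are at most 2^L supports, each with at most min(L, K) sites to fill. *)
Lemma sparse_count_le L K : 0 < r -> sparse_count L K <= 2 ^ L * r ^ minn L K.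
Proof.
move=> r0; elim: L K => [|L IH] [|K] //.
  by rewrite sparse_count0 minn0 muln1 expn_gt0.
rewrite /= expnS mul2n -addnn mulnDl minnSS leq_add//.
  by apply: leq_trans (IH _) _; rewrite leq_mul2l leq_pexp2l ?orbT//; lia.
by rewrite expnS mulnCA leq_mul2l IH orbT.
Qed.

Lemma sparse_count_ge L K : r ^ minn L K <= sparse_count L K.
Proof.
elim: L K => [|L IH] [|K] //; first by rewrite sparse_count0.
by rewrite minnSS expnS /= (leq_trans _ (leq_addl _ _))// leq_mul2l IH orbT.
Qed.

(** Here c stands for |j| and m for n + |j|. They are separate arguments so that |j| can be rounded
    up in the first and down in the second, which is what supermultiplicativity needs. *)
Definition best_count (c m : nat) : nat :=
  \max_(L < m.+1 | (c <= L) && (2 * L <= m)) sparse_count L (m - 2 * L).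

Lemma best_count_ge c m L :
  c <= L -> 2 * L <= m -> sparse_count L (m - 2 * L) <= best_count c m.
Proof.
move=> cL Lm; have L' : L < m.+1 by lia.
by rewrite (@leq_bigmax_cond _ _ (fun L : 'I_m.+1 => sparse_count L (m - 2 * L))
  (Ordinal L'))//= cL Lm.
Qed.

Lemma best_count_attained c m : 2 * c <= m ->
  exists L, [/\ c <= L, 2 * L <= m & best_count c m = sparse_count L (m - 2 * L)].
Proof.
move=> cm; have c' : c < m.+1 by lia.
rewrite /best_count (@bigop.bigmax_eq_arg _ (Ordinal c')) /= ?leqnn//.
by case: arg_maxnP => [|i /= /andP[ci im] _]; [rewrite /= leqnn|exists i].
Qed.

Lemma best_count_gt0 c m : 2 * c <= m -> 0 < best_count c m.
Proof.
move=> cm; apply: leq_trans _ (best_count_ge (leqnn c) cm).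
by rewrite -(sparse_count0 c) leq_sparse_count.
Qed.

(** The sum of two maximizing lengths is admissible for (c2, m2). The inequalities on c2 and m2 are
    those satisfied by ceilings and floors respectively. *)
Lemma best_countD c m c' m' c2 m2 : 2 * c <= m -> 2 * c' <= m' ->
    c2 <= c + c' -> m + m' <= m2 ->
  best_count c m * best_count c' m' <= best_count c2 m2.
Proof.
move=> /best_count_attained[L [cL Lm ->]] /best_count_attained[L' [cL' Lm' ->]].
move=> cc mm; apply: leq_trans (sparse_countD _ _ _ _) _.
have cLL : c2 <= L + L' by lia.
have LLm : 2 * (L + L') <= m2 by lia.
by apply: leq_trans _ (best_count_ge cLL LLm); apply: leq_sparse_count; lia.
Qed.

End SparseCount.

(** * Lower bound for the ball: words written along a walk *)

Section SparseWords.
Variable F : finGroupType.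
Implicit Types (w : seq F) (c : F) (x y : lamplighter F) (s i j k : int).

Definition nontrivial : pred F := predC1 1%g.

Fixpoint sparse_words (L K : nat) : seq (seq F) :=
  if L is L'.+1 then
    [seq 1%g :: w | w <- sparse_words L' K] ++
    (if K is K'.+1 then
       [seq c :: w | c <- rem 1%g (enum F), w <- sparse_words L' K'] else [::])
  else [:: [::]].

Lemma size_sparse_words r L K : #|F| = r.+1 ->
  size (sparse_words L K) = sparse_count r L K.
Proof.
move=> cF; elim: L K => //= L IH [|K]; rewrite size_cat size_map IH//.
by rewrite size_allpairs IH size_rem ?mem_enum// -cardE cF.
Qed.

Lemma mem_sparse_words L K w :
  (w \in sparse_words L K) = (size w == L) && (count nontrivial w <= K)%N.
Proof.
elim: L K w => [|L IH] K w /=; first by rewrite inE; case: w.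
rewrite mem_cat; case: w => [|c w] /=.
  rewrite -[LHS]negbK negb_or; apply/negbF; apply/andP; split.
    by apply/mapP => -[].
  by case: K => // K; apply/allpairsP => -[[]] /= ? ? [].
rewrite eqSS /nontrivial /=; have [->|c1] := eqVneq c 1%g.
  rewrite add0n mem_map ?IH; last by move=> ? ? [].
  case: K => [|K]; first by rewrite orbF.
  suff /negbTE-> : 1%g :: w \notin [seq c :: w | c <- rem 1%g (enum F), w <- sparse_words L K].
    by rewrite orbF.
  apply/allpairsP => -[[c' w']] /= [].
  by rewrite mem_rem_uniq ?enum_uniq// inE /= => /andP[/eqP ne _] _ [/esym/ne].
rewrite add1n; have -> /= : (c :: w \in [seq 1%g :: w | w <- sparse_words L K]) = false.
  by apply/negbTE/mapP => -[w' _ [e]]; rewrite e eqxx in c1.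
case: K => [|K]; first by rewrite andbF.
rewrite ltnS -IH; apply/allpairsP/idP => [[[c' w']] /= [_ ? [_ ->]]//|wK].
by exists (c, w); rewrite mem_rem_uniq ?enum_uniq// inE c1 mem_enum.
Qed.

Lemma uniq_sparse_words L K : uniq (sparse_words L K).
Proof.
elim: L K => //= L IH K; rewrite cat_uniq map_inj_uniq ?IH /=; last by move=> ? ? [].
case: K => //= K; apply/andP; split.
  apply/hasPn => _ /allpairsP[[c w]] /= [+ _ ->].
  rewrite mem_rem_uniq ?enum_uniq// inE /= => /andP[c1 _].
  by apply/mapP => -[w' _ [e]]; rewrite e eqxx in c1.
by apply: allpairs_uniq => //; [rewrite rem_uniq ?enum_uniq|move=> [? ?] [? ?] _ _ [-> ->]].
Qed.

(* The element reached by writing the letters of w while walking in the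
   direction s, which is 1 or -1. *)
Fixpoint walk s w : lamplighter F :=
  if w is c :: w' then (lamp c * (Lamplighter (conf1 F) s * walk s w'))%g else 1%g.

Lemma cursor_walk s w : cursor (walk s w) = s *+ size w.
Proof. by elim: w => //= c w IH; rewrite IH add0r mulrS. Qed.

(** As s is 1 or -1, every site has the form s * i, so one formula covers both directions; negative
    i are the sites behind the start, which stay trivial. *)
Lemma lamps_walk s w i : `|s|%N = 1%N ->
  lamps (walk s w) (s * i) = if i is Posz m then nth 1%g w m else 1%g.
Proof.
move=> s1; elim: w i => [|c w IH] i /=.
  by rewrite conf1E; case: i => // m; rewrite nth_nil.
rewrite !cmulE conf1E deltaE mul1g subr0.
have -> : s * i - s = s * (i - 1) by rewrite mulrBr mulr1.
rewrite IH; case: i => [[|m]|m].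
- by rewrite mulr0 eqxx mulg1.
- rewrite -[m.+1]addn1 PoszD addrK /= addn1 /= ifF ?mul1g//.
  by apply/negbTE/negP; lia.
- by rewrite ifF ?mul1g//; apply/negbTE/negP; lia.
Qed.

Lemma walk_inj s L : `|s|%N = 1%N ->
  {in [pred w | size w == L] &, injective (walk s)}.
Proof.
move=> s1 w w' /eqP wL /eqP wL' e; apply: (@eq_from_nth _ 1%g) => [|i _].
  by rewrite wL wL'.
by have := lamps_walk w (Posz i) s1; rewrite e (lamps_walk w' (Posz i) s1).
Qed.

Lemma gens_unit_shift s : `|s|%N = 1%N -> gens (Lamplighter (conf1 F) s).
Proof.
move=> s1; have /orP[/eqP->|/eqP->] : (s == 1) || (s == -1) by lia.
  by rewrite /gens /= eqxx.
apply/or3P/Or32/eqP; congr Lamplighter.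
by apply/fsfunP => i; rewrite cinvE !conf1E invg1.
Qed.

Lemma is_word_unit_shift s m : `|s|%N = 1%N ->
  is_word (Lamplighter (conf1 F) (s *+ m)) m.
Proof.
move=> s1; elim: m => [|m IH]; first exact: is_word1.
have := is_wordM (is_word_gen (gens_unit_shift s1)) IH.
rewrite lmulE /lmul /= -mulrS; congr (is_word (Lamplighter _ _) _).
by apply/fsfunP => i; rewrite cmulE !conf1E mulg1.
Qed.

Lemma lamp1 : lamp 1%g = 1%g :> lamplighter F.
Proof. by congr Lamplighter; apply/fsfunP => i; rewrite deltaE conf1E if_same. Qed.

Lemma is_word_walk s w : `|s|%N = 1%N ->
  is_word (walk s w) (count nontrivial w + size w).
Proof.
move=> s1; elim: w => [|c w IH] /=; first exact: is_word1.
have tw := is_wordM (is_word_gen (gens_unit_shift s1)) IH.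
have -> : nontrivial c = (c != 1%g) by [].
(* The trivial letter is not a generator: it costs nothing because [lamp 1] is the identity. *)
have [->|c1] := eqVneq c 1%g.
  by rewrite lamp1 mul1g; congr (is_word _ _): tw; lia.
have gc : gens (lamp c).
  by apply/or3P/Or33/existsP; exists c; rewrite c1 eqxx.
have ctw := is_wordM (is_word_gen gc) tw.
by congr (is_word _ _): ctw; lia.
Qed.

Lemma wlen_le x n : is_word x n -> (wlen x <= n)%N.
Proof. by rewrite /wlen; case: ex_minnP => m _; apply. Qed.

(** Walk L steps towards j while writing a word with at most K nontrivial letters, then go back L -
    |j| steps: the cost is at most K + 2L - |j| = n. *)
Lemma ball_count_ge r j n L : #|F| = r.+1 ->
    (`|j| <= L)%N -> (2 * L <= n + `|j|)%N ->
  (sparse_count r L (n + `|j| - 2 * L) <= ball_count F j n)%N.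
Proof.
move=> cF jL Ln; set K := (n + _ - _)%N.
have [s [s1 js]] : exists s : int, `|s|%N = 1%N /\ j = s *+ `|j|%N.
  case: (lerP 0 j) => j0; [exists 1|exists (-1)]; split=> //.
    by rewrite pmulrn intz; lia.
  by rewrite mulNrn pmulrn intz; lia.
have s'1 : `|- s|%N = 1%N by lia.
pose f w : lamplighter F :=
  (walk s w * Lamplighter (conf1 F) (- s *+ (L - `|j|)))%g.
rewrite -(size_sparse_words L K cF) -(size_map f) -(@undup_id _ (map f _)).
  rewrite -(size_seq_fset tt) /ball_count; apply: fsubset_leq_card.
  apply/fsubsetP => x; rewrite seq_fsetE => /mapP[w].
  rewrite mem_sparse_words => /andP[/eqP wL wK] ->.
  rewrite in_fset_set; last exact: ball_fiber_finite.
  apply/mem_set; split; last first.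
    by rewrite /f lmulE /= cursor_walk wL mulNrn -mulrnBr ?leq_subr// subKn.
  have := is_wordM (is_word_walk w s1) (is_word_unit_shift (L - `|j|) s'1).
  by move/wlen_le => /leq_trans; apply; rewrite wL; lia.
rewrite map_inj_in_uniq ?uniq_sparse_words// => w w'.
rewrite !mem_sparse_words => /andP[wL _] /andP[wL' _] /mulIg.
by apply: (walk_inj s1) wL wL'.
Qed.

End SparseWords.

(** * Upper bound for the ball: the interval visited by a word *)

Section BallUpperBound.
Variable F : finGroupType.
Implicit Types (w : seq F) (c : F) (x y : lamplighter F) (i j k : int).

(** The interval [-a, b] is the range visited by the cursor. Appending a letter on the right either
    moves the cursor or changes the lamp under it, so induction from the right follows the walk. *)
Lemma is_word_range x n : is_word x n -> exists a b : nat,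
  [/\ - a%:Z <= cursor x <= b,
      forall i, lamps x i != 1%g -> - a%:Z <= i <= b &
      (#|` finsupp (lamps x)| + 2 * (a + b) <= n + `|cursor x|)%N].
Proof.
move=> /asboolP[v [+ <- <-]]; elim/last_ind: v => [_|v y IH].
  exists 0%N, 0%N; rewrite big_nil; split=> //=.
    by move=> i; rewrite conf1E eqxx.
  suff -> : finsupp (conf1 F) = fset0 by rewrite cardfs0.
  by apply/fsetP => i; rewrite mem_finsupp conf1E eqxx inE.
rewrite all_rcons => /andP[gy /IH{IH}[a [b []]]]; rewrite -cats1 big_cat big_seq1.
rewrite size_cat /= addn1; set x' := (\prod_(z <- v) z)%g.
case: x' => f j /= jab fab fn.
have move_cursor s : `|s|%N = 1%N -> y = Lamplighter (conf1 F) s -> exists a b : nat,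
  [/\ - a%:Z <= cursor (Lamplighter f j * y)%g <= b,
      forall i, lamps (Lamplighter f j * y)%g i != 1%g -> - a%:Z <= i <= b &
      (#|` finsupp (lamps (Lamplighter f j * y)%g)| + 2 * (a + b) <=
         (size v).+1 + `|cursor (Lamplighter f j * y)%g|)%N].
  move=> s1 ->; have -> : (Lamplighter f j * Lamplighter (conf1 F) s)%g =
                          Lamplighter f (j + s).
    congr Lamplighter; apply/fsfunP => i.
    by rewrite cmulE conf1E mulg1.
  (* Inside the interval the new letter pays for a possible drop of |cursor|. On leaving it, 2(a +
     b) grows by 2, paid by the new letter and by |cursor| growing by 1. *)
  rewrite /=; have [jsab|] := boolP (- a%:Z <= j + s <= b).
    by exists a, b; split => //; lia.
  rewrite negb_and -!ltNge => /orP[js|js].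
    exists a.+1, b; split; [lia| |lia].
    by move=> i /fab; lia.
  exists a, b.+1; split; [lia| |lia].
  by move=> i /fab; lia.
case/or3P: gy => [/eqP yE|/eqP yE|/existsP[c /andP[c1 /eqP->]]].
- exact: (move_cursor 1 erefl yE).
- apply: (move_cursor (-1) erefl); rewrite yE; congr Lamplighter.
  by apply/fsfunP => i; rewrite cinvE !conf1E invg1.
exists a, b; rewrite /= addr0; split => //.
  move=> i; rewrite cmulE deltaE subr_eq0; case: (i =P j) => [->//|_].
  by rewrite mulg1; exact: fab.
have sub : (finsupp (cmul f j (delta c)) `<=` j |` finsupp f)%fset.
  apply/fsubsetP => i; rewrite !inE !mem_finsupp cmulE deltaE subr_eq0.
  by case: (i =P j) => //= _; rewrite mulg1.
have := fsubset_leq_card sub; have := cardfsU1 j (finsupp f).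
by case: (j \notin _) => /=; lia.
Qed.

Lemma size_flatten_le (T : Type) (M : nat) (ss : seq (seq T)) :
  all (fun s => size s <= M)%N ss -> (size (flatten ss) <= size ss * M)%N.
Proof.
elim: ss => //= s ss IH /andP[sM /IH ssM].
by rewrite size_cat mulSn leq_add.
Qed.

(** An element is determined by (a, b) and the word read on the a + b + 1 sites of [-a, b], whence
    [L.+1] with L = a + b. Since |j| <= L and 2L <= n + |j| force L <= n, there are at most (n +
    1)^2 pairs. *)
Lemma ball_count_le r j n M : #|F| = r.+1 ->
    (forall L, (`|j| <= L)%N -> (2 * L <= n + `|j|)%N ->
      (sparse_count r L.+1 (n + `|j| - 2 * L) <= M)%N) ->
  (ball_count F j n <= n.+1 ^ 2 * M)%N.
Proof.
move=> cF cM.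
(* Decoding: w is written rightwards from site -a, and the cursor is then set to j. *)
pose elt (a : nat) w : lamplighter F :=
  Lamplighter (lamps (Lamplighter (conf1 F) (- a%:Z) * walk 1 w)%g) j.
pose block (p : nat * nat) :=
  if (`|j| <= p.1 + p.2)%N && (2 * (p.1 + p.2) <= n + `|j|)%N then
    [seq elt p.1 w | w <- sparse_words F (p.1 + p.2).+1 (n + `|j| - 2 * (p.1 + p.2))]
  else [::].
pose l := flatten [seq block p | p <- [seq (a, b) | a <- iota 0 n.+1, b <- iota 0 n.+1]].
have sl : (size l <= n.+1 ^ 2 * M)%N.
  have := @size_flatten_le _ M
    [seq block p | p <- [seq (a, b) | a <- iota 0 n.+1, b <- iota 0 n.+1]].
  rewrite size_map size_allpairs !size_iota mulnn; apply.
  apply/allP => _ /mapP[p _ ->]; rewrite /block; case: ifP => // /andP[p1 p2].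
  by rewrite size_map (size_sparse_words _ _ cF) cM.
apply: leq_trans (leq_trans (size_undup l) sl).
rewrite -(size_seq_fset tt) /ball_count; apply: fsubset_leq_card.
apply/fsubsetP => x; rewrite seq_fsetE in_fset_set; last exact: ball_fiber_finite.
move/set_mem => [xn xj]; apply/flatten_mapP.
have xw : is_word x (wlen x) by rewrite /wlen; case: ex_minnP.
have [a [b [jab fab fn]]] := is_word_range xw.
rewrite xj in jab fn.
exists (a, b).
  by apply/allpairsP; exists (a, b); rewrite !mem_iota /=; split => //; lia.
rewrite /block ifT; last by apply/andP; split => /=; lia.
pose w := mkseq (fun i : nat => lamps x (i%:Z - a%:Z)) (a + b).+1.
apply/mapP; exists w.
  rewrite mem_sparse_words size_mkseq eqxx andTb.
  suff wf : (count (@nontrivial F) w <= #|` finsupp (lamps x)|)%N.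
    by apply: leq_trans wf _; move: fn xn; rewrite /=; lia.
  rewrite count_map -size_filter -(size_map (fun i : nat => i%:Z - a%:Z)).
  apply: uniq_leq_size.
    rewrite map_inj_uniq ?filter_uniq ?iota_uniq// => u v; lia.
  move=> _ /mapP[i + ->]; rewrite mem_filter => /andP[ix _].
  by rewrite mem_finsupp.
transitivity (Lamplighter (lamps x) j); first by case: (x) xj => ? ? /= ->.
congr Lamplighter.
apply/fsfunP => k; rewrite cmulE conf1E mul1g opprK.
have := @lamps_walk F 1 w (k + a%:Z) erefl; rewrite mul1r => ->.
(* Nontrivial sites lie in [-a, b], where w records them. A trivial site is recorded as 1 inside the
   interval and gets the default 1 of [nth] outside. *)
have [f1|/fab kab] := eqVneq (lamps x k) 1%g; last first.
  have -> : k + a = Posz `|(k + a)%R|%N by lia.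
  by rewrite nth_mkseq; [congr (lamps x _); lia|lia].
case e : (k + a) => [m|m] //; have [mab|mab] := ltnP m (a + b).+1.
  by rewrite nth_mkseq//; congr (lamps x _); lia.
by rewrite nth_default ?size_mkseq.
Qed.

End BallUpperBound.

(** * Limits of sequences *)

Section Limits.
Variable R : realType.

Lemma cvg_div_sqrt (X : R) : X / Num.sqrt n%:R @[n --> \oo] --> (0 : R).
Proof.
apply/cvgrPdist_lt => e e0; near=> n.
have n0 : 0 < n%:R :> R by near: n; exact: nbhs_infty_gtr.
have s0 : 0 < Num.sqrt n%:R :> R by rewrite sqrtr_gt0.
rewrite sub0r normrN normrM normfV (gtr0_norm s0) ltr_pdivrMr//.
rewrite mulrC -ltr_pdivrMr// -(@ger0_norm _ (`|X| / e)) -?sqrtr_sqr; last first.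
  by rewrite divr_ge0// ltW.
by rewrite ltr_sqrt//; near: n; exact: nbhs_infty_gtr.
Unshelve. all: by end_near. Qed.

(* Fekete's lemma. *)
Lemma superadditive_cvg (u : nat -> R) (n0 : nat) (M : R) :
    (forall n m, (n0 <= n)%N -> (n0 <= m)%N -> u n + u m <= u (n + m)%N) ->
    (forall n, (n0 <= n)%N -> 0 <= u n) ->
    (forall n, (n0 <= n)%N -> u n <= M * n%:R) ->
  cvgn (fun n => u n / n%:R).
Proof.
move=> uD u0 uM.
pose E := [set u m / m%:R | m in [set m | (n0 < m)%N]].
have Eub : has_ubound E.
  exists M => _ [m /= mn <-]; rewrite ler_pdivrMr ?uM 1?ltnW//.
  by rewrite ltr0n (leq_ltn_trans _ mn).
have Esup : has_sup E.
  by split => //; exists (u n0.+1 / n0.+1%:R); exists n0.+1 => /=.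
apply/cvg_ex; exists (sup E); apply/cvgrPdist_lt => e e0.
have [|_ [m /= mn <-] mE] := @sup_adherent _ E (e / 2) _ Esup; first lra.
have m0 : 0 < m%:R :> R by rewrite ltr0n (leq_ltn_trans _ mn).
near=> n.
have nn0 : (n0 + m < n)%N by near: n; exact: nbhs_infty_gt.
have n0' : 0 < n%:R :> R by rewrite ltr0n (leq_ltn_trans _ nn0).
have ub : u n / n%:R <= sup E.
  by apply: ub_le_sup => //; exists n => //=; lia.
(* Superadditivity holds only from n0 on, so the remainder s is kept at least n0: below, n is split
   as q m + (n0 + (n - n0) mod m). *)
have uq q s : (n0 <= s)%N -> q%:R * u m <= u (q * m + s)%N.
  move=> sn; elim: q => [|q IH]; first by rewrite mul0r add0n u0.
  rewrite mulSn -addnA -addn1 natrD mulrDl mul1r addrC.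
  apply: le_trans (uD _ _ (ltnW mn) _); last by lia.
  by rewrite lerD2l.
have := uq ((n - n0) %/ m)%N (n0 + (n - n0) %% m)%N (leq_addr _ _).
have -> : ((n - n0) %/ m * m + (n0 + (n - n0) %% m) = n)%N.
  by rewrite addnCA -divn_eq; lia.
move=> uqn.
have qm : n%:R <= ((n - n0) %/ m)%:R * m%:R + (n0 + m)%:R :> R.
  rewrite -natrM -natrD ler_nat; have := divn_eq (n - n0) m.
  have : ((n - n0) %% m < m)%N by rewrite ltn_mod (leq_ltn_trans _ mn).
  by lia.
have um0 : 0 <= u m / m%:R by rewrite divr_ge0// u0// ltnW.
have small : (n0 + m)%:R * (u m / m%:R) / n%:R < e / 2.
  rewrite ltr_pdivrMr// -ltr_pdivrMl ?divr_gt0//.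
  by near: n; exact: nbhs_infty_gtr.
have : u m / m%:R - (n0 + m)%:R * (u m / m%:R) / n%:R <= u n / n%:R.
  rewrite -{1}(mulfK (lt0r_neq0 n0') (u m / m%:R)) -mulrBl ler_pM2r ?invr_gt0//.
  apply: le_trans uqn; have := ler_wpM2l um0 qm.
  rewrite mulrDr mulrCA mulfVK ?lt0r_neq0//; lra.
by rewrite ger0_norm; lra.
Unshelve. all: by end_near. Qed.

End Limits.

(** * Estimates for the maximal count and comparison with the ball *)

Section BestCountBounds.
Local Open Scope nat_scope.

Lemma best_count_ge_expn r c m : 0 < r -> 2 * c <= m ->
  r ^ minn (m %/ 3) (m - 2 * c) <= best_count r c m.
Proof.
move=> r0 cm.
(* L and m - 2L balance at L = m / 3; if c is larger, the constraint c <= L is binding. *)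
pose L := maxn c (m %/ 3).
have cL : c <= L by rewrite leq_maxl.
have Lm : 2 * L <= m by rewrite /L; lia.
apply: leq_trans _ (best_count_ge r cL Lm).
apply: leq_trans _ (sparse_count_ge r L _).
by rewrite leq_pexp2l// /L; lia.
Qed.

(** Rounding |j| to f and c costs a polynomial factor. The exponent is 5 = 2 + 3: two for the choice
    of the interval, three for the excess budget. *)
Lemma ball_count_sandwich (F : finGroupType) r f c n (j : int) : #|F| = r.+1 ->
    f <= `|j| <= c -> c <= f.+1 -> 2 * c <= n + f ->
  best_count r c (n + f) <= ball_count F j n
    <= (r.+1 * n.+1) ^ 5 * best_count r c (n + f).
Proof.
move=> cF /andP[fj jc] cf cn; apply/andP; split.
  have [L [cL Ln ->]] := best_count_attained r cn.
  apply: leq_trans (leq_sparse_count _ _ _) (ball_count_ge cF (leq_trans jc cL) _); lia.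
set b := best_count _ _ _; have b0 : 0 < b by exact: best_count_gt0.
apply: leq_trans (ball_count_le (M := (r.+1 * n.+1) ^ 3 * b) cF _) _; last first.
  rewrite mulnA leq_mul2r (_ : 5 = 2 + 3)// expnD leq_mul2r; apply/orP; right.
  by apply/orP; right; rewrite leq_exp2r// leq_pmull.
move=> L jL Ln.
have step K : sparse_count r L.+1 K.+1 <= r.+1 * n.+1 * sparse_count r L.+1 K.
  apply: leq_trans (sparse_countS_le _ _ _) _; rewrite leq_mul2r; apply/orP; right.
  have Ln1 : L.+1 <= n.+1 by lia.
  apply: leq_trans (_ : 1 + n.+1 * r <= _); last by rewrite mulnC; nia.
  by rewrite leq_add2l leq_mul2r Ln1 orbT.
(* Replacing L by L + 1 lowers the budget by 2 and replacing |j| by f lowers it by at most 1, hence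
   three steps. *)
have step3 K : sparse_count r L.+1 K.+3 <= (r.+1 * n.+1) ^ 3 * sparse_count r L.+1 K.
  move: (r.+1 * n.+1) step => N step; rewrite !expnS expn0 muln1 -2!mulnA.
  by do 2! (apply: leq_trans (step _) _; apply: leq_mul => //).
have [Lm|Lm] := leqP (2 * L.+1) (n + f).
  have cL : c <= L.+1 by lia.
  apply: leq_trans (leq_trans _ (step3 (n + f - 2 * L.+1))) _.
    by apply: leq_sparse_count; lia.
  by rewrite leq_mul2l best_count_ge// orbT.
(* Here L + 1 is too long for [best_count], but then the budget n + |j| - 2L is at most 3 and
   positivity of the maximum suffices. *)
apply: leq_trans (leq_trans _ (step3 0)) _.
  by apply: leq_sparse_count; lia.
by rewrite sparse_count0 leq_mul2l b0 orbT.
Qed.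

End BestCountBounds.

(** * Existence of the directional limit and its bounds *)

Section GrowthSpectrum.
Variable R : realType.
Implicit Types (beta B : R).

Definition absfloor B (n : nat) : nat := `|Num.floor (B * n%:R)|%N.
Definition absceil B (n : nat) : nat := `|Num.ceil (B * n%:R)|%N.

Lemma absfloor_itv B n : 0 <= B ->
  (absfloor B n)%:R <= B * n%:R < (absfloor B n)%:R + 1.
Proof.
move=> B0; have x0 : 0 <= B * n%:R by rewrite mulr_ge0.
have e : Num.floor (B * n%:R) = absfloor B n.
  by rewrite /absfloor gez0_abs// floor_ge0.
by have := floor_itv (B * n%:R); rewrite e intrD.
Qed.

Lemma absceil_itv B n : 0 <= B ->
  (absceil B n)%:R - 1 < B * n%:R <= (absceil B n)%:R.
Proof.
move=> B0; have x0 : 0 <= B * n%:R by rewrite mulr_ge0.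
have e : Num.ceil (B * n%:R) = absceil B n.
  by rewrite /absceil gez0_abs// ceil_ge0// (lt_le_trans _ x0)// ltrN10.
by have := ceil_itv (B * n%:R); rewrite e intrB.
Qed.

(** The absolute value of the floor of beta n is the floor of |beta| n for beta >= 0 and its ceiling
    for beta < 0. *)
Lemma absz_floor_itv beta n :
  (absfloor `|beta| n <= `|Num.floor (beta * n%:R)| <= absceil `|beta| n)%N
  && (absceil `|beta| n <= (absfloor `|beta| n).+1)%N.
Proof.
have /andP[f1 f2] := absfloor_itv n (normr_ge0 beta).
have /andP[c1 c2] := absceil_itv n (normr_ge0 beta).
have fc : (absfloor `|beta| n <= absceil `|beta| n)%N by rewrite -(ler_nat R); lra.
have cf : (absceil `|beta| n <= (absfloor `|beta| n).+1)%N.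
  by rewrite -ltnS -(ltr_nat R) -[_.+2]addn2 natrD; lra.
rewrite cf andbT; case: (lerP 0 beta) => b0.
  have -> : `|Num.floor (beta * n%:R)|%N = absfloor `|beta| n.
    by rewrite /absfloor ger0_norm.
  by rewrite leqnn fc.
have -> : `|Num.floor (beta * n%:R)|%N = absceil `|beta| n.
  by rewrite /absceil ltr0_norm// mulNr ceilNfloor opprK abszN.
by rewrite fc leqnn.
Qed.

(** This makes the range of L in [best_count] nonempty. Two ceilings and a floor lose at most 3, so
    (1 - B) n >= 3 suffices; for B = 1 both roundings are exact. *)
Lemma double_absceil_near B : 0 <= B <= 1 ->
  exists n0, forall n, (n0 <= n)%N -> (2 * absceil B n <= n + absfloor B n)%N.
Proof.
move=> /andP[B0]; rewrite le_eqVlt => /orP[/eqP->|B1].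
  exists 0%N => n _; rewrite /absceil /absfloor mul1r.
  by rewrite -[n%:R]/((n%:Z)%:~R) intrKfloor intrKceil; lia.
exists (Num.truncn (3 / (1 - B))).+1 => n.
rewrite -(ler_nat R) => n0n.
have n3 : 3 <= (1 - B) * n%:R.
  rewrite mulrC -ler_pdivrMr ?subr_gt0//; apply: le_trans n0n.
  by apply: ltW; apply: truncnS_gt.
have /andP[f1 f2] := absfloor_itv n B0; have /andP[c1 c2] := absceil_itv n B0.
by rewrite -(ler_nat R) natrM natrD; lra.
Qed.

Lemma absfloorD B n m : 0 <= B ->
  (absfloor B n + absfloor B m <= absfloor B (n + m))%N.
Proof.
move=> B0; have := absfloor_itv n B0; have := absfloor_itv m B0.
have := absfloor_itv (n + m) B0; rewrite natrD mulrDr => /andP[_ +] /andP[+ _] /andP[+ _].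
by rewrite -ltnS -(ltr_nat R) natrD -natr1; lra.
Qed.

Lemma absceilD B n m : 0 <= B ->
  (absceil B (n + m) <= absceil B n + absceil B m)%N.
Proof.
move=> B0; have := absceil_itv n B0; have := absceil_itv m B0.
have := absceil_itv (n + m) B0; rewrite natrD mulrDr => /andP[+ _] /andP[_ +] /andP[_ +].
by rewrite -ltnS -(ltr_nat R) -natr1 natrD; lra.
Qed.

(** For the maximizing L, the number m = min(L, n + f - 2L) satisfies both constraints placed on m,
    and L <= n because 2L <= n + f <= 2n. *)
Lemma le_ln_best_count (r n f c : nat) (nu : R) : (0 < r)%N -> (f <= n)%N ->
    (2 * c <= n + f)%N ->
    (forall m, (3 * m <= n + f)%N -> (m + 2 * c <= n + f)%N -> m%:R <= nu) ->
  ln (best_count r c (n + f))%:R <= ln 2 * n%:R + nu * ln r%:R.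
Proof.
move=> r0 fn cn nuP; have [L [cL Ln ->]] := best_count_attained r cn.
have lnr : 0 <= ln r%:R :> R by rewrite ln_ge0// ler1n.
set K := (_ - _)%N; have rr : 0 < r%:R :> R by rewrite ltr0n.
have : ln (sparse_count r L K)%:R <= ln (2 ^ L * r ^ minn L K)%:R :> R.
  rewrite ler_ln ?posrE ?ltr0n ?muln_gt0 ?expn_gt0 ?r0//.
    by rewrite ler_nat sparse_count_le.
  by rewrite (leq_trans _ (leq_sparse_count r L (leq0n K)))// sparse_count0.
rewrite natrM (natrX _ 2 L) (natrX _ r) lnM ?posrE ?exprn_gt0//.
rewrite (lnXn L) // (lnXn (minn L K)) // -(mulr_natl _ L) -(mulr_natl _ (minn L K)).
move=> h; apply: le_trans h _; rewrite [ln 2 * _]mulrC lerD//.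
  by rewrite ler_wpM2r ?ln_ge0 ?ler1n// ler_nat; lia.
by rewrite ler_wpM2r// nuP /K; lia.
Qed.

(** The 2 is the largest remainder in the division of n + f by 3. *)
Lemma ge_ln_best_count (r n f c : nat) (nu : R) : (0 < r)%N -> (2 * c <= n + f)%N ->
    3 * nu <= (n + f)%:R - 2 -> nu <= (n + f)%:R - (2 * c)%:R ->
  nu * ln r%:R <= ln (best_count r c (n + f))%:R.
Proof.
move=> r0 cn nu3 nu1; have := best_count_ge_expn r0 cn.
set m := minn _ _ => mb; have rm : (0 < r ^ m)%N by rewrite expn_gt0 r0.
apply: le_trans (_ : ln (r ^ m)%:R <= _); last first.
  by rewrite ler_ln ?posrE ?ltr0n ?ler_nat// (leq_trans rm).
rewrite (natrX _ r m) (lnXn m) ?ltr0n// -(mulr_natl _ m) ler_wpM2r ?ln_ge0 ?ler1n//.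
rewrite /m /minn; case: ifP => _; last by rewrite natrB.
have : (n + f <= 3 * ((n + f) %/ 3) + 2)%N by lia.
by rewrite -(ler_nat R) [(3 * _ + 2)%:R]natrD (natrM _ 3); lra.
Qed.

Lemma growth_spectrum_bounds (F : finGroupType) (r : nat) beta (mu : R) :
    (0 < r)%N -> #|F| = r.+1 -> -1 <= beta <= 1 ->
    mu = Num.min ((1 + `|beta|) / 3) (1 - `|beta|) ->
  mu * ln r%:R <= growth_spectrum F beta <= ln 2 + mu * ln r%:R.
Proof.
move=> r0 cF b1; set B := `|beta| => muE.
have B01 : 0 <= B <= 1 by rewrite normr_ge0 ler_norml.
have [B0 B1] := andP B01.
have [n0 cn] := double_absceil_near B01.
pose best n := best_count r (absceil B n) (n + absfloor B n).
have best_gt0 n : (n0 <= n)%N -> (0 < best n)%N by move=> /cn; exact: best_count_gt0.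
have le_best n : (n0 <= n)%N -> ln (best n)%:R <= (ln 2 + mu * ln r%:R) * n%:R.
  move=> nn; have /andP[f1 _] := absfloor_itv n B0.
  have /andP[_ c1] := absceil_itv n B0.
  have n0' : 0 <= n%:R :> R by [].
  rewrite mulrDl [mu * _ * _]mulrAC; apply: le_ln_best_count (cn _ nn) _ => //.
    by rewrite -(ler_nat R); nra.
  move=> m; rewrite -!(ler_nat R) (natrM _ 3) (natrD _ m) (natrD _ n) (natrM _ 2) muE.
  by case: (lerP ((1 + B) / 3) (1 - B)) => _; lra.
(* The loss 3 covers n + f - 2c >= (1 - B) n - 3, one unit from the floor and two from the doubled
   ceiling. *)
have ge_best n : (n0 <= n)%N -> (mu * n%:R - 3) * ln r%:R <= ln (best n)%:R.
  move=> nn; have /andP[_ f1] := absfloor_itv n B0.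
  have /andP[c1 _] := absceil_itv n B0.
  have n0' : 0 <= n%:R :> R by [].
  have mu3 : 3 * mu <= 1 + B.
    by have : mu <= (1 + B) / 3 by [rewrite muE ge_min lexx]; lra.
  have mu1 : mu <= 1 - B by rewrite muE ge_min lexx orbT.
  have := ler_wpM2r n0' mu3; have := ler_wpM2r n0' mu1.
  by move=> h1 h3; apply: ge_ln_best_count (cn _ nn) _ _ => //; rewrite (natrD _ n) ?(natrM _ 2); lra.
have cvb : cvgn (fun n => ln (best n)%:R / n%:R : R).
  apply: (@superadditive_cvg _ _ n0 _ _ _ le_best) => [n m nn mn|n nn].
    have nnm : (n0 <= n + m)%N by rewrite (leq_trans nn)// leq_addr.
    rewrite -lnM ?posrE ?ltr0n ?best_gt0// -natrM.
    rewrite ler_ln ?posrE ?ltr0n ?muln_gt0 ?best_gt0//.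
    rewrite ler_nat best_countD ?cn ?absceilD//.
    by have := absfloorD n m B0; lia.
  by rewrite ln_ge0// ler1n best_gt0.
(* With y = (r + 1)(n + 1), the sandwich costs 5 ln y <= 10 sqrt y, and y <= 2 (r + 1) n for n >= 1;
   dividing by n gives [err]. *)
pose err n : R := 10 * Num.sqrt (2 * r.+1%:R) / Num.sqrt n%:R.
have cv0 : err n @[n --> \oo] --> (0 : R) by exact: cvg_div_sqrt.
(* Convergence is established here, so the [limn] in [growth_spectrum] is a genuine limit. *)
have cvN : (ln (ball_count F (Num.floor (beta * n%:R)) n)%:R / n%:R : R) @[n --> \oo]
    --> limn (fun n => ln (best n)%:R / n%:R : R).
  apply: (squeeze_cvgr (f := fun n => ln (best n)%:R / n%:R)
    (h := fun n => err n + ln (best n)%:R / n%:R) _ cvb _); last first.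
    by rewrite -[X in _ --> X]add0r; exact: cvgD cv0 cvb.
  near=> n.
  have nn0 : (n0 <= n)%N by near: n; exact: nbhs_infty_ge.
  have n_gt0 : (0 < n)%N by near: n; exact: nbhs_infty_gt.
  have /andP[fjc cf] := absz_floor_itv beta n.
  have := ball_count_sandwich cF fjc cf (cn _ nn0).
  rewrite -/(best n); set N := ball_count _ _ _ => /andP[bN Nb].
  have b_gt0 := best_gt0 _ nn0; have N_gt0 := leq_trans b_gt0 bN.
  have nR : 0 < n%:R :> R by rewrite ltr0n.
  rewrite ler_pM2r ?invr_gt0// ler_ln ?posrE ?ltr0n// ler_nat bN /=.
  rewrite ler_pdivrMr// mulrDl mulfVK ?lt0r_neq0//.
  set y := (r.+1 * n.+1)%N in Nb; have y_gt0 : 0 < y%:R :> R by rewrite ltr0n.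
  have yN : ln N%:R <= 5 * ln y%:R + ln (best n)%:R :> R.
    rewrite mulr_natl -lnXn// -natrX -lnM ?posrE ?ltr0n ?expn_gt0// -natrM.
    by rewrite ler_ln ?posrE ?ltr0n ?ler_nat// (leq_trans N_gt0).
  apply: le_trans yN _; rewrite lerD2r.
  have lny : ln y%:R <= 2 * Num.sqrt y%:R :> R.
    rewrite -{1}(sqr_sqrtr (ltW y_gt0)) lnXn ?sqrtr_gt0// -[leLHS]mulr_natl ler_pM2l//.
    by apply/ltW/ln_sublinear; rewrite sqrtr_gt0.
  have sy : Num.sqrt y%:R <= Num.sqrt (2 * r.+1%:R) * Num.sqrt n%:R :> R.
    rewrite -sqrtrM ?mulr_ge0// ler_wsqrtr// -!natrM ler_nat /y; nia.
  have -> : err n * n%:R = 10 * (Num.sqrt (2 * r.+1%:R) * Num.sqrt n%:R).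
    rewrite /err -{2}(sqr_sqrtr (ltW nR)) expr2 !mulrA mulfVK//.
    by rewrite lt0r_neq0// sqrtr_gt0.
  lra.
rewrite /growth_spectrum (cvg_lim _ cvN)//; apply/andP; split.
  (* The deficit 3 ln r / n is enlarged to 3 ln r / sqrt n so that [cvg_div_sqrt] applies. *)
  pose err3 n : R := 3 * ln r%:R / Num.sqrt n%:R.
  have cv3 : err3 n @[n --> \oo] --> (0 : R) by exact: cvg_div_sqrt.
  rewrite -[leRHS]add0r.
  apply: (ler_cvg_to (cvg_cst (mu * ln r%:R)) (cvgD cv3 cvb)).
  near=> n.
  have nn0 : (n0 <= n)%N by near: n; exact: nbhs_infty_ge.
  have n_gt0 : (0 < n)%N by near: n; exact: nbhs_infty_gt.
  have nR : 0 < n%:R :> R by rewrite ltr0n.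
  have sn : 1 <= Num.sqrt n%:R :> R by rewrite -[leLHS]sqrtr1 ler_wsqrtr// ler1n.
  rewrite /= -(ler_pM2r nR) mulrDl mulfVK ?lt0r_neq0//.
  have -> : err3 n * n%:R = 3 * ln r%:R * Num.sqrt n%:R.
    rewrite /err3 -{2}(sqr_sqrtr (ltW nR)) expr2 !mulrA mulfVK//.
    by rewrite lt0r_neq0// (lt_le_trans ltr01).
  have lnr : 0 <= ln r%:R :> R by rewrite ln_ge0// ler1n.
  by have := ge_best _ nn0; have := ler_wpM2l lnr sn; lra.
apply: limr_le => //; near=> n.
have n_gt0 : (0 < n)%N by near: n; exact: nbhs_infty_gt.
rewrite ler_pdivrMr ?ltr0n// le_best//.
by near: n; exact: nbhs_infty_ge.
Unshelve. all: by end_near. Qed.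

End GrowthSpectrum.

(** * Limits of the two critical slopes *)

Section Constants.
Variable R : realType.

(** Shared by both slopes, with x equal to [rho] or [omega]: the hypothesis gives x <= 1 + sqrt r <=
    2 sqrt r, so x / r tends to 0. *)
Lemma cvg_half_sqrt_le (g x : nat -> R) :
    (forall r, (0 < r)%N -> 1 <= x r /\ (x r - 1) ^+ 2 <= r%:R) ->
    (forall r, (0 < r)%N -> 0 <= g r - 2^-1 <= x r / r%:R) ->
  g r @[r --> \oo] --> (2^-1 : R).
Proof.
move=> xP gP.
apply: (squeeze_cvgr (f := cst 2^-1) (h := fun r => 2 / Num.sqrt r%:R + 2^-1)).
- near=> r; have r0 : (0 < r)%N by near: r; exact: nbhs_infty_gt.
  have [x1 xr] := xP _ r0; have /andP[g0 gx] := gP _ r0.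
  have rR : 0 < r%:R :> R by rewrite ltr0n.
  have s1 : 1 <= Num.sqrt r%:R :> R by rewrite -[leLHS]sqrtr1 ler_wsqrtr// ler1n.
  have xs : x r <= 2 * Num.sqrt r%:R.
    by move: (ler_wsqrtr xr); rewrite sqrtr_sqr ger0_norm ?subr_ge0//; lra.
  rewrite /= -subr_ge0 g0 /= -lerBlDr (le_trans gx)//.
  rewrite ler_pdivrMr// mulrAC ler_pdivlMr ?(lt_le_trans ltr01)//.
  by rewrite -[leRHS]mulr1 -{2}(sqr_sqrtr (ltW rR)); nra.
- exact: cvg_cst.
- by rewrite -[X in _ --> X]add0r; apply: cvgD (cvg_cst _); exact: cvg_div_sqrt.
Unshelve. all: by end_near. Qed.

Lemma beta_star_cvg : beta_star R r @[r --> \oo] --> (2^-1 : R).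
Proof.
apply: (@cvg_half_sqrt_le _ (rho R)) => r r0; have [r1 re] := rhoP R r0.
  (* Here r = rho (rho - 1)(rho + 1) >= (rho - 1)^2. *)
  by split; [lra|nra].
have rR : 0 < r%:R :> R by rewrite ltr0n.
have -> : beta_star R r - 2^-1 = rho R r / (2 * (2 * r%:R + rho R r)).
  by rewrite /beta_star /u_; field; lra.
rewrite divr_ge0 ?ler_wpM2l ?lef_pV2 ?posrE//=; lra.
Qed.

Lemma beta_bar_cvg : beta_bar R r @[r --> \oo] --> (2^-1 : R).
Proof.
have oP r : (0 < r)%N -> 1 <= omega R r /\ omega R r ^+ 2 = omega R r + r%:R.
  move=> r0; have rR : 0 < r%:R :> R by rewrite ltr0n.
  have s2 : Num.sqrt (1 + 4 * r%:R) ^+ 2 = 1 + 4 * r%:R :> R by rewrite sqr_sqrtr; lra.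
  have s0 : 0 <= Num.sqrt (1 + 4 * r%:R) :> R by exact: sqrtr_ge0.
  by rewrite /omega; split; nra.
apply: (@cvg_half_sqrt_le _ (omega R)) => r r0; have [r1 re] := oP r r0.
  (* Here r = omega (omega - 1) >= (omega - 1)^2. *)
  by split; [lra|nra].
have rR : 0 < r%:R :> R by rewrite ltr0n.
have -> : beta_bar R r - 2^-1 = omega R r / (2 * (2 * r%:R + omega R r)).
  by rewrite /beta_bar re; field; lra.
rewrite divr_ge0 ?ler_wpM2l ?lef_pV2 ?posrE//=; lra.
Qed.

End Constants.

Theorem proposition1p9 (R : realType) :
  [/\ exists C : R, forall r : nat, (2 <= r)%N ->
        forall F : finGroupType, #|F| = r.+1 ->
        (ereal_sup [set (spectrum_error F r beta)%:E
                   | beta in [set beta : R | (-1 <= beta <= 1)%R]]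
         <= (C / ln r%:R)%:E)%E,
      (beta_star R r @[r --> \oo] --> (2^-1 : R)) &
      (beta_bar R r @[r --> \oo] --> (2^-1 : R))].
Proof.
(* The constant ln 2 is the gap between the two bounds of [growth_spectrum_bounds], the same for all
   beta and F; the lower bound removes the absolute value. *)
split; [exists (ln 2)|exact: beta_star_cvg|exact: beta_bar_cvg].
move=> r r2 F cF; apply: ge_ereal_sup => _ [beta /= b1 <-]; rewrite lee_fin.
rewrite /spectrum_error; set mu := Num.min _ _.
have /andP[lo up] := growth_spectrum_bounds (ltnW r2) cF b1 (erefl mu).
have lnr : 0 < ln r%:R :> R by rewrite ln_gt0// ltr1n.
rewrite ger0_norm ?subr_ge0 ?ler_pdivlMr//.
by rewrite mulrBl mulfVK ?lt0r_neq0//; lra.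
Qed.
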